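(* Let $L>0$ be an integer, let $G$ be a graph and let $w$ be a normal weight function on $G$. Assume that there is no $L$-banana in $G$. Then there exists a clique $K$ in $G$ with the following property: for every $X\subseteq V(G)\setminus K$ such that $w(D)\leq\frac12$ for every component $D$ of $G\setminus(K\cup N[X])$, there exists a $w$-balanced separator $Y$ in $G$ such that $|Y\setminus K|\leq 3L|X|$.
   Context: A normal weight function on $G$ is $w:V(G)\to\mathbb{R}_{\ge0}$ with $\sum_{v}w(v)=1$, and $w(Z)=\sum_{z\in Z}w(z)$. A set $Y$ is a $w$-balanced separator if $w(D)\le\frac12$ for every component $D$ of $G\setminus Y$. $N[X]$ is the closed neighborhood of $X$. For vertices $a,b$, $ab$ is an $L$-banana if $a,b$ are non-adjacent and there exist $L$ pairwise internally vertex-disjoint paths from $a$ to $b$; ''no $L$-banana in $G$'' means no pair of vertices of $G$ is an $L$-banana. *)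

(* Defs.v *)
From mathcomp Require Import all_boot all_order all_algebra.
From mathcomp Require Import reals.

Set Implicit Arguments.
Unset Strict Implicit.
Unset Printing Implicit Defensive.

Import Order.TTheory GRing.Theory Num.Theory.

Local Open Scope ring_scope.

(* A graph is a symmetric irreflexive relation e on a finType T. *)
Definition simple_graph (T : finType) (e : rel T) : Prop :=
  symmetric e /\ irreflexive e.

(* The empty set is a clique. *)
Definition clique (T : finType) (e : rel T) (K : {set T}) : Prop :=
  {in K &, forall x y, x != y -> e x y}.

Definition closed_nbhd (T : finType) (e : rel T) (X : {set T}) : {set T} :=
  X :|: [set v | [exists x in X, e x v]].

Definition induced (T : finType) (e : rel T) (A : {set T}) : rel T :=
  [rel x y | [&& x \in A, y \in A & e x y]].

(* Vertex sets of the connected components of G[A]; those of G \ Y are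
   obtained with A := ~: Y. *)
Definition components (T : finType) (e : rel T) (A : {set T}) : {set {set T}} :=
  [set [set y | connect (induced e A) x y] | x in A].

(* The path has vertex sequence a :: p. *)
Definition path_between (T : finType) (e : rel T) (a b : T) (p : seq T) : Prop :=
  [/\ path e a p, last a p = b & uniq (a :: p)].

Definition interior (T : finType) (a b : T) (p : seq T) : {set T} :=
  [set x in a :: p] :\: [set a; b].

(* Non-adjacent vertices are distinct by convention. The paths are
   automatically distinct: as a and b are non-adjacent, interiors are nonempty. *)
Definition banana (T : finType) (e : rel T) (L : nat) (a b : T) : Prop :=
  [/\ a != b, ~~ e a b &
      exists P : 'I_L -> seq T,
        (forall i, path_between e a b (P i)) /\
        (forall i j, i != j ->
           [disjoint interior a b (P i) & interior a b (P j)])].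

Definition weight (R : realType) (T : finType) (w : T -> R) (A : {set T}) : R :=
  \sum_(x in A) w x.

Definition normal_weight (R : realType) (T : finType) (w : T -> R) : Prop :=
  (forall v, 0 <= w v) /\ \sum_v w v = 1.

Definition balanced_separator (R : realType) (T : finType) (e : rel T)
    (w : T -> R) (Y : {set T}) : Prop :=
  forall D, D \in components e (~: Y) -> weight w D <= 2^-1.

(* Main.v *)
(* Let K be the set of vertices v such that, for every S of size less than L
   avoiding v, the component of v in G \ S has weight greater than 1/2. Two
   non-adjacent vertices of K would be separated by such an S, by Menger's
   theorem, giving two disjoint components of weight greater than 1/2; so K is a
   clique. Each x in X lies outside K, hence has a set S_x of size less than L
   for which the component C_x of x in G \ S_x has weight at most 1/2. Let
   Y = K u U_x S_x. A component D of G \ Y of weight greater than 1/2 cannot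
   meet any C_x, so it avoids N[x], which is contained in C_x u S_x. Hence D lies
   in a component of G \ (K u N[X]), which has weight at most 1/2. *)

Require Import Defs.
From mathcomp Require Import all_boot all_order all_algebra.
From mathcomp Require Import boolp reals.

Set Implicit Arguments.
Unset Strict Implicit.
Unset Printing Implicit Defensive.

Import Order.TTheory GRing.Theory Num.Theory.

Local Open Scope ring_scope.

(** * Separators, linkages and Menger's theorem between two vertex sets *)

(** The walk [p] may be empty, so a separator contains [A :&: B]. *)
Definition separates (T : finType) (e : rel T) (A B S : {set T}) : Prop :=
  forall a p, a \in A -> path e a p -> last a p \in B -> has (mem S) (a :: p).

(* The paths of a linkage are indexed by their first vertices [A']. *)
Definition linkage (T : finType) (e : rel T) (A B A' : {set T})
    (f : T -> seq T) : Prop :=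
  [/\ A' \subset A, {in A', forall a, path e a (f a)},
      {in A', forall a, last a (f a) \in B} &
      {in A' &, forall a b z, z \in a :: f a -> z \in b :: f b -> a = b}].

(** Only the ordered pair is removed: Menger's theorem is proved for digraphs. *)
Definition del_edge (T : finType) (e : rel T) (x y : T) : rel T :=
  [rel u v | e u v && ((u, v) != (x, y))].

Section Menger.
Variable T : finType.
Implicit Types (e : rel T) (A B S P Q : {set T}) (p : seq T).

(** Shortening a walk keeps its ends and adds no vertex, so disjointness survives. *)
Lemma linkage_uniq e A B A' f : linkage e A B A' f ->
  exists2 g, linkage e A B A' g & {in A', forall a, uniq (a :: g a)}.
Proof.
case=> sA' pf lf df; exists (fun a => shorten a (f a)); last first.
  by move=> a /pf; case/shortenP.
split=> // [a /pf|a aA'|a b aA' bA' z].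
- by case/shortenP.
- by move: (pf a aA') (lf a aA'); case/shortenP.
- case/shortenP: (pf a aA') => p1 _ _ s1; case/shortenP: (pf b bA') => p2 _ _ s2.
  move=> z1 z2; apply: (df a b aA' bA' z).
  + by move: z1; rewrite !inE => /orP[->//|/s1 ->]; rewrite orbT.
  + by move: z2; rewrite !inE => /orP[->//|/s2 ->]; rewrite orbT.
Qed.

Lemma first_hit P a p : has (mem P) (a :: p) ->
  exists p1 p2, [/\ p = p1 ++ p2, last a p1 \in P & ~~ has (mem P) (belast a p1)].
Proof.
elim: p a => [|b p IH] a.
  by rewrite /= orbF => aP; exists [::], [::].
have [aP _|aP] := boolP (a \in P); first by exists [::], (b :: p).
rewrite [has _ _]/= (negbTE aP) orFb => /IH[p1 [p2 [-> lP nP]]].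
by exists (b :: p1), p2; rewrite /= negb_or aP nP.
Qed.

Lemma last_hit P a p : has (mem P) (a :: p) ->
  exists p1 p2, [/\ p = p1 ++ p2, last a p1 \in P & ~~ has (mem P) p2].
Proof.
elim: p a => [|b p IH] a.
  by rewrite /= orbF => aP; exists [::], [::].
have [/IH[p1 [p2 [-> lP nP]]] _|nP] := boolP (has (mem P) (b :: p)).
  by exists (b :: p1), p2.
rewrite [has _ _]/= => /orP[aP|]; first by exists [::], (b :: p).
by move=> h; rewrite /= h in nP.
Qed.

Lemma sub_del_edge e x y : subrel (del_edge e x y) e.
Proof. by move=> u v /andP[]. Qed.

Lemma path_del_edgel e x y a p :
  path e a p -> x \notin belast a p -> path (del_edge e x y) a p.
Proof.
elim: p a => //= b p IH a /andP[eab pp]; rewrite inE negb_or => /andP[xa xp].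
by rewrite IH // /del_edge /= eab xpair_eqE eq_sym (negbTE xa).
Qed.

Lemma path_del_edger e x y a p :
  path e a p -> y \notin p -> path (del_edge e x y) a p.
Proof.
elim: p a => //= b p IH a /andP[eab pp]; rewrite inE negb_or => /andP[yb yp].
by rewrite IH // /del_edge /= eab xpair_eqE [b == y]eq_sym (negbTE yb) andbF.
Qed.

Lemma separates_del_edgel e x y A B S :
  separates (del_edge e x y) A B S -> separates e A B (x |: S).
Proof.
move=> sS a p aA pp lp; have [xp|xp] := boolP (x \in a :: p).
  by apply/hasP; exists x => //=; rewrite setU11.
have /hasP[z zp zS] : has (mem S) (a :: p).
  apply: sS => //; apply: path_del_edgel => //.
  by apply: contraNN xp => /mem_belast.
by apply/hasP; exists z => //; apply: setU1r.
Qed.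

Lemma separates_del_edger e x y A B S :
  separates (del_edge e x y) A B S -> separates e A B (y |: S).
Proof.
move=> sS a p aA pp lp; have [yp|yp] := boolP (y \in a :: p).
  by apply/hasP; exists y => //=; rewrite setU11.
have /hasP[z zp zS] : has (mem S) (a :: p).
  apply: sS => //; apply: path_del_edger => //.
  by apply: contraNN yp => yp; rewrite inE yp orbT.
by apply/hasP; exists z => //; apply: setU1r.
Qed.

(** Cut at its first vertex in [P], an [A]-[B] walk can visit [x] only at its end, so it does not
    use the edge [xy]. *)
Lemma separates_to e x y A B P S : x \in P -> separates e A B P ->
  separates (del_edge e x y) A P S -> separates e A B S.
Proof.
move=> xP sP sS a p aA pp lp; have := sP a p aA pp lp.
case/first_hit=> p1 [p2 [Ep lP nP]]; move: pp; rewrite Ep cat_path => /andP[pp _].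
have : has (mem S) (a :: p1).
  apply: sS => //; apply: path_del_edgel => //.
  by apply: contraNN nP => xp; apply/hasP; exists x.
by rewrite -cat_cons has_cat => ->.
Qed.

(** Mirror image: after its last vertex in [Q], a walk never enters [y]. *)
Lemma separates_from e x y A B Q S : y \in Q -> separates e A B Q ->
  separates (del_edge e x y) Q B S -> separates e A B S.
Proof.
move=> yQ sQ sS a p aA pp lp; have := sQ a p aA pp lp.
case/last_hit=> p1 [p2 [Ep lQ nQ]]; move: pp; rewrite Ep cat_path => /andP[_ pp].
have : has (mem S) (last a p1 :: p2).
  apply: sS => //; last by rewrite -last_cat -Ep.
  apply: path_del_edger => //.
  by apply: contraNN nQ => yp; apply/hasP; exists y.
case/hasP=> z zp zS; apply/hasP; exists z => //.
rewrite -cat_cons mem_cat; move: zp; rewrite inE => /orP[/eqP->|->].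
  by rewrite mem_last.
by rewrite orbT.
Qed.

(* A common vertex outside [S] would allow a switch from [f a] to [g q]. *)
Lemma linkage_meet e A B S x y A' f g :
  separates e A B S -> linkage e A (x |: S) A' f ->
  {in A', forall a, uniq (a :: f a)} ->
  {in A', forall a z, z \in a :: f a -> z \in x |: S -> z = last a (f a)} ->
  linkage e (y |: S) B (y |: S) g ->
  {in y |: S, forall q, uniq (q :: g q)} ->
  {in A' & y |: S, forall a q z, z \in a :: f a -> z \in q :: g q -> z \in S}.
Proof.
move=> sS [sA' pf lf df] uf Hf [_ pg lg dg] ug a q aA' qQ z zf zg.
apply/negPn/negP => zS.
case/splitPl Ef: (f a) / zf => [p1 p2 l1].
case/splitPl Eg: (g q) / zg => [q1 q2 l2].
have : has (mem S) (a :: p1 ++ q2).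
  apply: sS; first exact: (subsetP sA').
  - move: (pf a aA') (pg q qQ); rewrite Ef Eg !cat_path l1 l2.
    by case/andP=> -> _ /andP[_ ->].
  - by have := lg q qQ; rewrite Eg !last_cat l1 l2.
rewrite -cat_cons has_cat => /orP[] /hasP[s sp /= sS'].
  (* If [s] is on the first half, it is also the end of [f a]; so [f a] repeats [s], or it ends at
     [z], which then lies in [S]. *)
  have := Hf a aA' s; rewrite Ef -cat_cons mem_cat sp setU1r // => /(_ isT isT).
  rewrite last_cat l1 => Es; have := uf a aA'; rewrite Ef -cat_cons cat_uniq.
  case: p2 Es {Ef} => [/= Es|c p2 Es]; first by rewrite -Es sS' in zS.
  case/and3P=> _ /hasP nsp _; apply: nsp; exists s => //.
  by rewrite Es /=; apply: mem_last.
(* If [s] is on the second half, it starts a path of [g] itself, so [s = q] by disjointness and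
   [q :: g q] repeats [q]. *)
have sg : s \in q :: g q by rewrite Eg inE mem_cat sp !orbT.
have Es := dg q s qQ (setU1r y sS') s sg (mem_head _ _).
by have := ug q qQ; rewrite /= Eg mem_cat Es sp orbT.
Qed.

(* Goering's induction on the number of edges: if deleting [xy] leaves a
   separator [S] with [#|S| < k], then [x |: S] and [y |: S] are minimum
   separators of [e], and linkages from [A] to [x |: S] and from [y |: S] to [B]
   avoiding [xy] are glued along [S] and the edge [xy]. *)
Theorem menger e A B k :
  (forall S, separates e A B S -> (k <= #|S|)%N) ->
  exists A' f, linkage e A B A' f /\ #|A'| = k.
Proof.
have [n] := ubnP #|[set uv | e uv.1 uv.2]|.
elim: n e A B => // n IH e A B /ltnSE len hk.
case: (pickP [pred uv | e uv.1 uv.2]) => [[x y] /= exy|e0]; last first.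
  (* Without edges all walks are single vertices, and [k] vertices of [A :&: B] form a linkage. *)
  have /hk : separates e A B (A :&: B).
    move=> a [|b p] /= aA; first by rewrite orbF inE aA.
    by have /= -> := e0 (a, b).
  case/card_geqP=> s [us ss sAB]; exists [set z in s], (fun=> [::]); split.
    split=> // [|a|a b _ _ z].
    - by apply/subsetP=> z; rewrite inE => /sAB; rewrite inE => /andP[].
    - by rewrite inE => /sAB; rewrite inE => /andP[].
    - by rewrite !inE => /eqP-> /eqP.
  by rewrite -ss; rewrite cardsE; apply/card_uniqP.
pose e' := del_edge e x y.
have lt_e' : (#|[set uv | e' uv.1 uv.2]| < n)%N.
  apply: leq_trans len; apply: proper_card; apply/properP; split.
    by apply/subsetP=> uv; rewrite !inE => /andP[].
  by exists (x, y); rewrite !inE // /e' /del_edge /= eqxx andbF.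
have [hk'|] := pselect (forall S, separates e' A B S -> (k <= #|S|)%N).
  have [A' [f [[sA' pf lf df] cA']]] := IH e' A B lt_e' hk'.
  exists A', f; split=> //; split=> // a /pf.
  by apply: sub_path; apply: sub_del_edge.
move/existsNP=> [S /not_implyP[sS /negP]]; rewrite -ltnNge => ltS.
have sP := separates_del_edgel sS; have sQ := separates_del_edger sS.
have [xS cP] : x \notin S /\ #|x |: S| = k.
  have := hk _ sP; rewrite cardsU1; case: (x \in S) => /= h.
    by rewrite add0n leqNgt ltS in h.
  by split=> //; apply/eqP; rewrite eqn_leq h ltS.
have [yS cQ] : y \notin S /\ #|y |: S| = k.
  have := hk _ sQ; rewrite cardsU1; case: (y \in S) => /= h.
    by rewrite add0n leqNgt ltS in h.
  by split=> //; apply/eqP; rewrite eqn_leq h ltS.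
have [] := IH e' A (x |: S) lt_e'.
  by move=> R sR; apply: hk; apply: separates_to sP sR; rewrite setU11.
move=> A' [f0 [/linkage_uniq[f Lf uf] cA']].
have [] := IH e' (y |: S) B lt_e'.
  by move=> R sR; apply: hk; apply: separates_from sQ sR; rewrite setU11.
move=> Q [g0 [/linkage_uniq[g Lg ug] cQ']].
(* Both sets have [k] elements, so a path starts at every vertex of [y |: S]. *)
have EQ : Q = y |: S.
  by case: Lg => sQ' _ _ _; apply/eqP; rewrite eqEcard sQ' cQ cQ' leqnn.
move: Lg ug {cQ'}; rewrite EQ => Lg ug {Q EQ g0 f0}.
case: (Lf) => sA' pf lf df; case: (Lg) => _ pg lg dg.
pose t a := last a (f a).
have tf a : t a \in a :: f a by apply: mem_last.
have t_inj : {in A' &, injective t}.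
  by move=> a b aA' bA' Et; apply: (df a b aA' bA' (t a)); rewrite // Et.
(* By counting, every vertex of [x |: S] ends some path; by disjointness, no other path visits
   it. *)
have Et : t @: A' = x |: S.
  apply/eqP; rewrite eqEcard card_in_imset // cA' cP leqnn andbT.
  by apply/subsetP=> _ /imsetP[a aA' ->]; apply: lf.
have Hf : {in A', forall a z, z \in a :: f a -> z \in x |: S -> z = t a}.
  move=> a aA' z zf; rewrite -Et => /imsetP[b bA' Ez].
  by rewrite Ez (df a b aA' bA' z) // Ez.
have meet := linkage_meet sS Lf uf Hf Lg ug.
(* The second path continuing [f a] starts at [s a]: at [t a] itself when this is in [S], and at
   [y], reached by the edge [xy], when [t a = x]. *)
pose s a := if t a == x then y else t a.
pose h a := f a ++ (if t a == x then y :: g y else g (t a)).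
have sQs a : a \in A' -> s a \in y |: S.
  rewrite /s => /lf; rewrite -/(t a) !inE; case: (t a == x) => //=.
    by rewrite eqxx.
  by move=> ->; rewrite orbT.
have s_inj : {in A' &, injective s}.
  move=> a b aA' bA' Es; apply: t_inj => //; move: Es (lf a aA') (lf b bA').
  rewrite -/(t a) -/(t b) /s !inE.
  have [->|_] := eqVneq (t a) x; have [->|_] := eqVneq (t b) x => //= Es.
    by rewrite -Es => _ yS'; rewrite yS' in yS.
  by rewrite Es => yS'; rewrite yS' in yS.
have hE a z : z \in a :: h a -> z \in a :: f a \/ z \in s a :: g (s a).
  rewrite -cat_cons mem_cat /s => /orP[->|]; first by left.
  by case: eqP => _ zg; right => //; rewrite inE zg orbT.
exists A', h; split=> //; split=> // [a aA'|a aA'|a b aA' bA' z].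
- have sub := sub_path (@sub_del_edge e x y).
  rewrite cat_path -/(t a) (sub _ _ (pf a aA')) /=.
  have := sQs a aA'; rewrite /s; case: eqP => [->|_] qQ.
    by rewrite /= exy sub // pg.
  by rewrite sub // pg.
- have := sQs a aA'; rewrite /h last_cat -/(t a) /s; case: eqP => _ qQ /=;
  exact: lg.
(* A vertex shared by a first and a second segment lies in [S], hence is the gluing point of both
   walks. *)
- have cross c d : c \in A' -> d \in A' -> z \in c :: f c ->
      z \in s d :: g (s d) -> c = d.
    move=> cA dA zf zg; have zS := meet c (s d) cA (sQs d dA) z zf zg.
    have Ez := Hf c cA z zf (setU1r x zS).
    have Ez' := dg (s d) z (sQs d dA) (setU1r y zS) z zg (mem_head _ _).
    apply: s_inj => //; rewrite Ez' /s -Ez; case: eqP => // zx.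
    by rewrite -zx zS in xS.
  case/hE=> za; case/hE=> zb.
  + exact: (df a b aA' bA' z).
  + exact: cross.
  + by rewrite (cross b a).
  + apply: s_inj => //; exact: (dg _ _ (sQs a aA') (sQs b bA') z).
Qed.

End Menger.

(** * Menger's theorem for two non-adjacent vertices *)

Lemma path_induced (T : finType) (e : rel T) (A : {set T}) a p :
  path (induced e A) a p -> path e a p /\ {subset p <= A}.
Proof.
elim: p a => [|b p IH] a //= /andP[/and3P[_ bA ->] /IH[-> sp]]; split=> // z.
by rewrite inE => /orP[/eqP->|/sp].
Qed.

Lemma induced_path (T : finType) (e : rel T) (A : {set T}) a p :
  path e a p -> {subset a :: p <= A} -> path (induced e A) a p.
Proof.
elim: p a => [|b p IH] a //= /andP[eab pp] sA; rewrite /induced /= eab.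
rewrite !sA ?mem_head ?inE ?eqxx ?orbT //= IH // => z zp.
by rewrite sA // inE zp orbT.
Qed.

(** Menger's theorem is applied between the neighborhoods of [a] and [b] in the graph without [a]
    and [b]. Adding these two ends to [L] linked paths would give a banana. *)
Lemma menger_nonadjacent (T : finType) (e : rel T) (L : nat) (a b : T) :
  simple_graph e -> a != b -> ~~ e a b -> ~ banana e L a b ->
  exists S : {set T}, [/\ (#|S| < L)%N, a \notin S, b \notin S &
    ~~ connect (induced e (~: S)) a b].
Proof.
move=> [es ei] nab neab nban; pose C := ~: [set a; b].
pose A := [set v | e a v]; pose B := [set v | e v b].
have [sep|] := pselect (forall S, separates (induced e C) A B S -> (L <= #|S|)%N).
  exfalso; apply: nban; split=> //.
  have [A' [f0 [/linkage_uniq[f [sA' pf lf df] uf] cA']]] := menger sep.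
  have sC v : v \in A' -> {subset v :: f v <= C}.
    move=> vA'; have [_ sf] := path_induced (pf v vA'); move=> z.
    rewrite inE => /orP[/eqP->|/sf //]; have := subsetP sA' v vA'.
    rewrite !inE negb_or => eav; apply/andP; split.
      by apply: contraTneq eav => ->; rewrite ei.
    by apply: contraTneq eav => ->.
  have vP (i : 'I_L) : enum_val (cast_ord (esym cA') i) \in A' by apply: enum_valP.
  pose v i := enum_val (cast_ord (esym cA') i).
  pose P i := rcons (v i :: f (v i)) b.
  have intP i : {subset interior a b (P i) <= v i :: f (v i)}.
    move=> z; rewrite !inE negb_or mem_rcons !inE.
    by case/andP=> /andP[/negbTE-> /negbTE->].
  exists P; split=> [i|i j nij].
    have [pfi _] := path_induced (pf _ (vP i)).
    have := subsetP sA' _ (vP i); have := lf _ (vP i); rewrite !inE => ebl eav.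
    split; rewrite /P.
    - by rewrite rcons_path /= eav pfi.
    - by rewrite last_rcons.
    - have aN : a \notin v i :: f (v i).
        by apply/negP=> /(sC _ (vP i)); rewrite !inE eqxx.
      have bN : b \notin v i :: f (v i).
        by apply/negP=> /(sC _ (vP i)); rewrite !inE eqxx orbT.
      rewrite cons_uniq mem_rcons in_cons negb_or nab aN rcons_uniq bN.
      exact: (uf _ (vP i)).
  rewrite disjoints_subset; apply/subsetP=> z /intP zi; rewrite inE.
  apply/negP=> /intP zj; move/eqP: nij; apply.
  by move/enum_val_inj/cast_ord_inj: (df _ _ (vP i) (vP j) z zi zj).
move/existsNP=> [S /not_implyP[sS /negP]]; rewrite -ltnNge => ltS.
exists (S :\: [set a; b]); rewrite !inE !eqxx orbT; split=> //.
  by apply: leq_ltn_trans ltS; apply: subset_leq_card; apply: subsetDl.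
apply/negP=> /connectP[p0 pp0 Eb]; case/shortenP: pp0 Eb => p pp up _ {p0} Eb.
have [pe sp] := path_induced pp.
(* As [a] and [b] are distinct and non-adjacent, the path has inner vertices; they form an [A]-[B]
   walk in [C], which must meet [S]. *)
case: p => [|c p] in pp up Eb pe sp *; first by rewrite Eb eqxx in nab.
case/lastP: p => [|p d] in pp up Eb pe sp *.
  by move: pe; rewrite /= andbT -[c]Eb (negbTE neab).
rewrite /= last_rcons in Eb; rewrite -{d}Eb in pp up pe sp *.
move: pe; rewrite /= rcons_path => /and3P[eac pe elb].
move: up; rewrite -rcons_cons cons_uniq rcons_uniq mem_rcons in_cons negb_or.
case/and3P=> /andP[_ aN] bN _.
have sC : {subset c :: p <= C}.
  move=> z zp; rewrite !inE negb_or; apply/andP; split.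
    by apply: contraNneq aN => <-.
  by apply: contraNneq bN => <-.
have /hasP[z zp /= zS] : has (mem S) (c :: p).
  by apply: sS; rewrite ?inE //; apply: induced_path.
have : z \in c :: rcons p b by rewrite -rcons_cons mem_rcons in_cons zp orbT.
by move/sp; have := sC z zp; rewrite !inE => ->; rewrite zS.
Qed.

(** * Connectivity in induced subgraphs, and weights *)

Lemma connect_induced_sub (T : finType) (e : rel T) (A B : {set T}) x y :
  A \subset B -> connect (induced e A) x y -> connect (induced e B) x y.
Proof.
move=> /subsetP sAB; apply: connect_sub => u v /and3P[uA vA euv].
by apply: connect1; rewrite /induced /= !sAB.
Qed.

(** The assumption on [x] excludes the trivial path at a vertex outside [A]. *)
Lemma connect_induced_mem (T : finType) (e : rel T) (A : {set T}) x y :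
  x \in A -> connect (induced e A) x y -> y \in A.
Proof.
move=> xA /connectP[p /path_induced[_ sp] ->].
by have := mem_last x p; rewrite inE => /orP[/eqP->|/sp].
Qed.

Lemma connect_induced_sym (T : finType) (e : rel T) (A : {set T}) :
  symmetric e -> connect_sym (induced e A).
Proof.
by move=> es; apply: sym_connect_sym => u v; rewrite /induced /= es andbCA.
Qed.

Section Weight.
Variables (R : realType) (T : finType) (w : T -> R).
Hypothesis hw : normal_weight w.

Lemma weight_sub (A B : {set T}) : A \subset B -> weight w A <= weight w B.
Proof.
case: hw => w0 _ sAB; rewrite /weight [leRHS](big_setID A) /= (setIidPr sAB).
by rewrite lerDl sumr_ge0.
Qed.

(** Two disjoint sets heavier than one half would together exceed the total weight 1. *)
Lemma weight_disjoint (A B : {set T}) : [disjoint A & B] ->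
  weight w A <= 2^-1 \/ weight w B <= 2^-1.
Proof.
move=> dAB; case: (lerP (weight w A) 2^-1) => [|hA]; first by left.
right; rewrite leNgt; apply/negP => hB.
have : weight w (A :|: B) <= 1.
  have -> : 1 = weight w [set: T].
    by case: hw => _ <-; apply: eq_bigl => i; rewrite inE.
  by apply: weight_sub; apply: subsetT.
have -> : weight w (A :|: B) = weight w A + weight w B.
  by rewrite /weight -bigU //; apply: eq_bigl => i; rewrite !inE.
rewrite leNgt => /negP; apply.
by rewrite (splitr 1) mul1r ltrD.
Qed.

End Weight.

(** * The clique and the balanced separator *)

Theorem theorem9p2 (R : realType) (T : finType) (e : rel T) (w : T -> R)
    (L : nat) (hL : (0 < L)%N) (he : simple_graph e) (hw : normal_weight w)
    (hban : forall a b : T, ~ banana e L a b) :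
  exists K : {set T},
    clique e K /\
    forall X : {set T},
      X \subset ~: K ->
      (forall D : {set T},
         D \in components e (~: (K :|: closed_nbhd e X)) ->
         weight w D <= 2^-1) ->
      exists Y : {set T},
        balanced_separator e w Y /\ (#|Y :\: K| <= 3 * L * #|X|)%N.
Proof.
case: (he) => es ei.
pose comp (S : {set T}) x := [set y | connect (induced e (~: S)) x y].
(* For [x] in [S], [comp S x] would be just [[set x]] and not a component, hence the condition
   [x \notin S]. *)
pose light x (S : {set T}) := [&& (#|S| < L)%N, x \notin S & weight w (comp S x) <= 2^-1].
pose K := [set x | ~~ [exists S : {set T}, light x S]].
exists K; split=> [a b|X /subsetP sX hX].
  rewrite !inE => aK bK nab; apply/negPn/negP => neab.
  have [S [cS aS bS nc]] := menger_nonadjacent he nab neab (hban a b).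
  have : [disjoint comp S a & comp S b].
    rewrite disjoints_subset; apply/subsetP=> z; rewrite !inE => az.
    apply: contra nc => bz; apply: connect_trans az _.
    by rewrite connect_induced_sym.
  case/(weight_disjoint hw) => h; [case/negP: aK|case/negP: bK];
    by apply/existsP; exists S; apply/and3P.
have [S hS] : exists S : T -> {set T}, {in X, forall x, light x (S x)}.
  (* The default [set0] is never taken on [X], which is disjoint from [K]. *)
  exists (fun x => odflt set0 [pick S | light x S]) => x /sX.
  rewrite !inE negbK => /existsP[S hS]; case: pickP => //= /(_ S).
  by rewrite hS.
exists (K :|: \bigcup_(x in X) S x); split; last first.
  rewrite setDUl setDv set0U; apply: leq_trans (subset_leq_card (subsetDl _ _)) _.
  (* Each [S x] has fewer than [L] elements, so the union has at most [L * #|X|]. *)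
  apply: (@leq_trans (\sum_(x in X) L)).
    elim/big_rec2: _ => [|x n Z xX IH]; first by rewrite cards0.
    apply: leq_trans (leq_card_setU _ _) _; apply: leq_add => //.
    by case/and3P: (hS x xX) => /ltnW.
  by rewrite sum_nat_const mulnC leq_mul2r leq_pmull // orbT.
set Y := _ :|: _ => D /imsetP[d dY ->]; rewrite leNgt; apply/negP => hD.
have SY x : x \in X -> ~: Y \subset ~: S x.
  move=> xX; rewrite setCS; apply: subset_trans (subsetUr _ _).
  exact: bigcup_sup.
(* Since [S x] is contained in [Y], a component of [~: Y] meeting [comp (S x) x] lies inside it; but
   the former is heavy and the latter light. *)
have far z x : connect (induced e (~: Y)) d z -> x \in X ->
    ~~ connect (induced e (~: S x)) x z.
  move=> dz xX; apply/negP=> xz; case/and3P: (hS x xX) => _ _.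
  rewrite leNgt => /negP; apply; apply: lt_le_trans hD _; apply: weight_sub => //.
  apply/subsetP=> y; rewrite !inE => dy; apply: connect_trans xz _.
  apply: connect_induced_sub (SY x xX) _; apply: connect_trans _ dy.
  by rewrite connect_induced_sym.
have sub z : connect (induced e (~: Y)) d z ->
    z \in ~: (K :|: closed_nbhd e X).
  move=> dz; have zY := connect_induced_mem dY dz; rewrite inE in zY.
  rewrite inE; apply: contra zY; rewrite !inE => /or3P[->//|zX|/existsP[x]].
    by have := far z z dz zX; rewrite connect0.
  (* A neighbor [z] of [x] outside [Y] is outside [S x], so the edge [xz] puts it in [comp (S x) x],
     against [far]. *)
  case/andP=> xX exz; have := far z x dz xX; apply: contraNT => zY.
  have zS : z \in ~: S x by apply: (subsetP (SY x xX)); rewrite !inE.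
  by apply: connect1; case/and3P: (hS x xX) => _ xS _; rewrite /induced /= zS inE xS.
have /hX : comp (K :|: closed_nbhd e X) d \in components e (~: (K :|: closed_nbhd e X)).
  by apply/imsetP; exists d => //; apply: sub.
rewrite leNgt => /negP; apply; apply: lt_le_trans hD _; apply: weight_sub => //.
apply/subsetP=> z; rewrite !inE => /connectP[p pp ->]; apply/connectP.
(* All vertices of the path are reachable from [d] in [~: Y], so [sub] keeps the whole path outside
   [K] and the closed neighborhood of [X]. *)
exists p => //; have [pe _] := path_induced pp; apply: induced_path => // y yp.
by apply: sub; exact: (path_connect pp).
Qed.
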